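(* For a Stokes wave (irrotational steady periodic water wave over a flat bed, as described in the context), every streamline $y=y(x)$ other than the bed $y=-d$ has at least one inflection point with $x\in(0,\pi)$.
   Context: Setting (Stokes wave, in the moving frame $(x,y)=(X-ct,Y)$). Let $g>0$, $d>0$, $c$, $P_{atm}$ be real constants. The fluid occupies $\{(x,y): x\in\mathbb{R},\ -d\le y\le \eta(x)\}$, with flat bed $y=-d$ and free surface $y=\eta(x)>-d$. The velocity field $(u,v)$ and the pressure $P$ are classical (smooth up to the boundary) and satisfy, in the fluid, $u_x+v_y=0$, $u_y-v_x=0$ (irrotational flow), $(u-c)u_x+vu_y=-P_x$, $(u-c)v_x+vv_y=-P_y-g$; on the bed $v=0$; on the free surface $v=(u-c)\eta'(x)$ and $P=P_{atm}$. Standing assumptions: (1) $\eta,u,v,P$ are $2\pi$-periodic in $x$; (2) $\eta,u,P$ are even in $x$ and $v$ is odd in $x$; (3) $u<c$ everywhere in the closed fluid region; (4) the crest is at $(0,\eta(0))$ and the troughs at $(\pm\pi,\eta(\pm\pi))$; (5) each streamline other than the bed is strictly monotone between successive crest and trough lines, with $y'(x)<0$ for $x\in(0,\pi)$. Streamlines: the stream function $\psi$ is defined by $\psi_x=-v$, $\psi_y=u-c$, $\psi=0$ on $y=\eta(x)$. Streamlines are the level sets of $\psi$; since $\psi_y<0$ each is a graph $y=y(x)$, and the free surface and the bed are streamlines. Each streamline, including the free surface, is the graph of a real-analytic function. An inflection point of a streamline is a point $(x_0,y(x_0))$ at which the streamline changes between strictly convex and strictly concave (i.e. $y''$ changes sign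 at $x_0$). *)

(* Defs.v *)
From Stdlib Require Import Reals ZArith.
From Coquelicot Require Import Coquelicot.

Open Scope R_scope.

Definition in_fluid (d : R) (eta : R -> R) (x y : R) : Prop :=
  - d <= y <= eta x.

Definition in_fluid_interior (d : R) (eta : R -> R) (x y : R) : Prop :=
  - d < y < eta x.

Definition dx (f : R -> R -> R) (x y : R) : R := Derive (fun t => f t y) x.
Definition dy (f : R -> R -> R) (x y : R) : R := Derive (fun t => f x t) y.

Definition continuous_on_fluid (d : R) (eta : R -> R) (f : R -> R -> R) : Prop :=
  continuous_on (fun p : R * R => in_fluid d eta (fst p) (snd p))
                (fun p : R * R => f (fst p) (snd p)).

(* Smoothness up to the boundary: all partial derivatives exist in the open
   fluid and extend continuously to the closed one.  [F i j] is the extension of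
   the derivative of order [i] in [x] and [j] in [y].  Partial derivatives are
   never taken at boundary points: horizontal neighbours of a surface point need
   not lie in the fluid. *)
Definition smooth_up_to_boundary (d : R) (eta : R -> R) (f : R -> R -> R) : Prop :=
  exists F : nat -> nat -> R -> R -> R,
    F 0%nat 0%nat = f /\
    forall i j : nat,
      continuous_on_fluid d eta (F i j) /\
      forall x y : R, in_fluid_interior d eta x y ->
        is_derive (fun t => F i j t y) x (F (S i) j x y) /\
        is_derive (fun t => F i j x t) y (F i (S j) x y).

Definition real_analytic (f : R -> R) : Prop :=
  forall x0 : R, exists (a : nat -> R) (r : R), 0 < r /\
    forall x : R, Rabs (x - x0) < r -> is_pseries a (x - x0) (f x).

Definition strictly_monotone_on (a b : R) (f : R -> R) : Prop :=
  (forall x1 x2 : R, a <= x1 -> x1 < x2 -> x2 <= b -> f x1 < f x2) \/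
  (forall x1 x2 : R, a <= x1 -> x1 < x2 -> x2 <= b -> f x2 < f x1).

(* The bulk equations are imposed in the open fluid; since all fields are smooth
   up to the boundary they then hold, by continuity, on the closed fluid. *)
Record steady_irrotational_flow (g d c Patm : R) (eta : R -> R)
    (u v P : R -> R -> R) : Prop := {
  surface_above_bed : forall x, - d < eta x;
  surface_analytic : real_analytic eta;
  u_smooth : smooth_up_to_boundary d eta u;
  v_smooth : smooth_up_to_boundary d eta v;
  P_smooth : smooth_up_to_boundary d eta P;
  incompressible : forall x y, in_fluid_interior d eta x y ->
    dx u x y + dy v x y = 0;
  irrotational : forall x y, in_fluid_interior d eta x y ->
    dy u x y - dx v x y = 0;
  euler_x : forall x y, in_fluid_interior d eta x y ->
    (u x y - c) * dx u x y + v x y * dy u x y = - dx P x y;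
  euler_y : forall x y, in_fluid_interior d eta x y ->
    (u x y - c) * dx v x y + v x y * dy v x y = - dy P x y - g;
  bed_condition : forall x, v x (- d) = 0;
  kinematic_condition : forall x,
    v x (eta x) = (u x (eta x) - c) * Derive eta x;
  dynamic_condition : forall x, P x (eta x) = Patm
}.

Record stream_function (d c : R) (eta : R -> R) (u v psi : R -> R -> R) : Prop := {
  psi_continuous : continuous_on_fluid d eta psi;
  psi_x : forall x y, in_fluid_interior d eta x y ->
    is_derive (fun t => psi t y) x (- v x y);
  psi_y : forall x y, in_fluid_interior d eta x y ->
    is_derive (fun t => psi x t) y (u x y - c);
  psi_surface : forall x, psi x (eta x) = 0
}.

Definition is_streamline (d : R) (eta : R -> R) (psi : R -> R -> R)
    (Y : R -> R) : Prop :=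
  exists k : R, forall x y : R,
    (in_fluid d eta x y /\ psi x y = k) <-> y = Y x.

Definition is_bed (d : R) (Y : R -> R) : Prop := forall x : R, Y x = - d.

Record stokes_wave (g d c Patm : R) (eta : R -> R)
    (u v P psi : R -> R -> R) : Prop := {
  sw_flow : steady_irrotational_flow g d c Patm eta u v P;
  sw_psi : stream_function d c eta u v psi;
  eta_periodic : forall x, eta (x + 2 * PI) = eta x;
  fields_periodic : forall x y, in_fluid d eta x y ->
    u (x + 2 * PI) y = u x y /\
    v (x + 2 * PI) y = v x y /\
    P (x + 2 * PI) y = P x y;
  eta_even : forall x, eta (- x) = eta x;
  fields_parity : forall x y, in_fluid d eta x y ->
    u (- x) y = u x y /\ v (- x) y = - v x y /\ P (- x) y = P x y;
  no_stagnation : forall x y, in_fluid d eta x y -> u x y < c;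
  crest : forall x, eta x <= eta 0;
  troughs : forall x, eta PI <= eta x /\ eta (- PI) <= eta x;
  (* The crest and trough lines are x = k PI for k an integer. *)
  streamlines_monotone : forall Y, is_streamline d eta psi Y -> ~ is_bed d Y ->
    (forall k : Z, strictly_monotone_on (IZR k * PI) (IZR (k + 1) * PI) Y) /\
    (forall x, 0 < x < PI -> Derive Y x < 0);
  streamlines_analytic : forall Y, is_streamline d eta psi Y -> real_analytic Y
}.

Definition changes_sign_at (f : R -> R) (x0 : R) : Prop :=
  exists eps : R, 0 < eps /\
    ((forall x, x0 - eps < x < x0 -> f x < 0) /\
     (forall x, x0 < x < x0 + eps -> 0 < f x) \/
     (forall x, x0 - eps < x < x0 -> 0 < f x) /\
     (forall x, x0 < x < x0 + eps -> f x < 0)).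

Definition inflection_at (Y : R -> R) (x0 : R) : Prop :=
  changes_sign_at (Derive_n Y 2) x0.

(* Main.v *)
(** A streamline is analytic, and it is symmetric about both the crest line
    [x = 0] and the trough line [x = PI], since the stream function inherits
    evenness and periodicity from [u].  Hence its slope vanishes at [0] and
    [PI] while being negative in between, so the second derivative takes a
    negative value and, further right, a positive one.  Zeros of an analytic
    function that is not locally zero are isolated, so at the last point where
    the second derivative passes from negative to nonnegative it changes sign
    strictly. *)

Require Import Defs.
From Stdlib Require Import Reals ZArith Lra Classical Wf_nat.
From Coquelicot Require Import Coquelicot.

Open Scope R_scope.

(** * Power series and real-analytic functions *)

(** Were the radius smaller than [r], the series would converge at some point strictly outside its
    disk, where its terms do not tend to 0. *)
Lemma CV_radius_ge_of_ex_pseries (a : nat -> R) (r : R) :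
  (forall x, Rabs x < r -> ex_pseries a x) -> Rbar_le r (CV_radius a).
Proof.
  intros Ha. apply Rbar_not_lt_le. intros Hlt.
  assert (Hx : exists x, Rabs x < r /\ Rbar_lt (CV_radius a) (Rabs x)).
  { pose proof (CV_radius_ge_0 a) as Hge.
    destruct (CV_radius a) as [q| |]; simpl in Hlt, Hge; try contradiction.
    exists ((q + r) / 2). simpl.
    rewrite Rabs_pos_eq by lra. lra. }
  destruct Hx as [x [Hxr Hx]].
  apply (CV_disk_outside a x Hx), ex_series_lim_0, ex_pseries_R, Ha, Hxr.
Qed.

Lemma real_analytic_local (f : R -> R) (x0 : R) : real_analytic f ->
  exists (a : nat -> R) (r : R), 0 < r /\ Rbar_le r (CV_radius a) /\
    forall x, Rabs (x - x0) < r -> f x = PSeries a (x - x0).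
Proof.
  intros Hf. destruct (Hf x0) as (a & r & Hr & Ha).
  exists a, r. split; [exact Hr|split].
  - apply CV_radius_ge_of_ex_pseries. intros h Hh. exists (f (x0 + h)).
    specialize (Ha (x0 + h)). replace (x0 + h - x0) with h in Ha by ring.
    now apply Ha.
  - intros x Hx. symmetry. now apply is_pseries_unique, Ha.
Qed.

Lemma real_analytic_is_derive_local (f : R -> R) (x0 : R) : real_analytic f ->
  exists (a : nat -> R) (r : R), 0 < r /\ Rbar_le r (CV_radius a) /\
    forall x, Rabs (x - x0) < r ->
      is_derive f x (PSeries (PS_derive a) (x - x0)).
Proof.
  intros Hf. destruct (real_analytic_local f x0 Hf) as (a & r & Hr & Hrad & Ha).
  exists a, r. split; [exact Hr|split; [exact Hrad|]].
  intros x Hx.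
  apply is_derive_ext_loc with (fun t => PSeries a (t - x0)).
  (* A ball of this radius around [x] stays inside the disk of radius [r] around [x0]. *)
  - assert (He : 0 < r - Rabs (x - x0)) by lra.
    exists (mkposreal _ He). intros t Ht. symmetry. apply Ha.
    change (Rabs (t - x) < r - Rabs (x - x0)) in Ht.
    replace (t - x0) with ((t - x) + (x - x0)) by ring.
    pose proof (Rabs_triang (t - x) (x - x0)). lra.
  - replace (PSeries (PS_derive a) (x - x0))
      with (scal 1 (PSeries (PS_derive a) (x - x0))) by (apply Rmult_1_l).
    apply (is_derive_comp (PSeries a) (fun t => t - x0)).
    + apply is_derive_PSeries.
      apply Rbar_lt_le_trans with r; [exact Hx|exact Hrad].
    + auto_derive; [exact I|ring].
Qed.

Lemma real_analytic_ex_derive (f : R -> R) (x : R) :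
  real_analytic f -> ex_derive f x.
Proof.
  intros Hf.
  destruct (real_analytic_is_derive_local f x Hf) as (a & r & Hr & _ & Ha).
  eexists. apply Ha. now replace (x - x) with 0 by ring; rewrite Rabs_R0.
Qed.

Lemma real_analytic_Derive (f : R -> R) :
  real_analytic f -> real_analytic (Derive f).
Proof.
  intros Hf x0.
  destruct (real_analytic_is_derive_local f x0 Hf) as (a & r & Hr & Hrad & Ha).
  exists (PS_derive a), r. split; [exact Hr|]. intros x Hx.
  rewrite (is_derive_unique _ _ _ (Ha x Hx)).
  apply PSeries_correct, CV_radius_inside. rewrite CV_radius_derive.
  apply Rbar_lt_le_trans with r; [exact Hx|exact Hrad].
Qed.

(* Factor out the lowest-order term, [f x = (x - x0) ^ m * h x] with
   [h x0 <> 0]: the product at two points on the same side is positive. *)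
Lemma real_analytic_one_sided_sign (f : R -> R) (x0 : R) : real_analytic f ->
  exists eps : R, 0 < eps /\
    ((forall x, Rabs (x - x0) < eps -> f x = 0) \/
     (forall x y, Rabs (x - x0) < eps -> Rabs (y - x0) < eps ->
        0 < (x - x0) * (y - x0) -> 0 < f x * f y)).
Proof.
  intros Hf. destruct (real_analytic_local f x0 Hf) as (a & r & Hr & Hrad & Ha).
  destruct (classic (exists n, a n <> 0)) as [Hn|Hn].
  - destruct (dec_inh_nat_subset_has_unique_least_element
                (fun n => a n <> 0) (fun n => classic _) Hn)
      as (m & [Hm Hmin] & _).
    set (b := PS_decr_n a m).
    assert (Hfac : forall x, PSeries a x = x ^ m * PSeries b x).
    { intros x. apply PSeries_decr_n_aux. intros k Hk. apply NNPP. intros Hak.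
      apply Hmin in Hak. apply (Nat.lt_irrefl k).
      now apply Nat.lt_le_trans with m. }
    assert (Hb : Rbar_le r (CV_radius b)).
    { apply CV_radius_ge_of_ex_pseries. intros x Hx. apply ex_pseries_decr_n.
      (* Dropping the first [m] terms divides by [x ^ m], hence the case split on [x = 0]. *)
      - destruct (Req_dec x 0) as [->|Hx0]; [now left|right].
        exists (/ x). now apply Rinv_l.
      - apply CV_radius_inside.
        apply Rbar_lt_le_trans with r; [exact Hx|exact Hrad]. }
    assert (Hb0 : PSeries b 0 <> 0).
    { rewrite PSeries_0. unfold b, PS_decr_n. now rewrite Nat.add_0_r. }
    assert (Hc : continuity_pt (PSeries b) 0).
    { apply PSeries_continuity.
      apply Rbar_lt_le_trans with r; [|exact Hb].
      simpl. now rewrite Rabs_R0. }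
    (* With tolerance [Rabs (PSeries b 0)], the values of [PSeries b] near 0 keep the sign of
       [PSeries b 0]. *)
    destruct (proj1 (continuity_pt_locally _ _) Hc
                (mkposreal _ (Rabs_pos_lt _ Hb0))) as [e He].
    simpl in He.
    assert (Hprod : forall h k, Rabs h < e -> Rabs k < e ->
              0 < PSeries b h * PSeries b k).
    { assert (Hnear : forall h, Rabs h < e ->
                Rabs (PSeries b h - PSeries b 0) < Rabs (PSeries b 0)).
      { intros h Hh. apply He.
        change (Rabs (h - 0) < e). now rewrite Rminus_0_r. }
      intros h k Hh Hk. apply Hnear in Hh, Hk.
      revert Hh Hk. unfold Rabs. repeat destruct Rcase_abs; intros; nra. }
    exists (Rmin r e). split; [apply Rmin_pos; [exact Hr|apply cond_pos]|right].
    intros x y Hx Hy Hxy.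
    pose proof (Rmin_l r e). pose proof (Rmin_r r e).
    rewrite !Ha, !Hfac by lra.
    replace (_ * _) with (((x - x0) * (y - x0)) ^ m
                          * (PSeries b (x - x0) * PSeries b (y - x0)))
      by (rewrite Rpow_mult_distr; ring).
    apply Rmult_lt_0_compat; [now apply pow_lt|apply Hprod; lra].
  - exists r. split; [exact Hr|left]. intros x Hx. rewrite Ha by exact Hx.
    rewrite (PSeries_ext a (fun _ => 0)).
    + apply PSeries_const_0.
    + intros n. apply NNPP. intros Han. apply Hn. now exists n.
Qed.

(** Let [s] be the supremum of the points of [[a, b]] where [f] is negative. Such points accumulate
    at [s] from the left, and [f] is nonnegative on the right, so [f s = 0] by continuity. Constancy
    of sign on each side of [s] then makes both signs strict. *)
Lemma real_analytic_changes_sign (f : R -> R) (a b : R) : real_analytic f ->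
  a < b -> f a < 0 -> 0 < f b ->
  exists x0, a < x0 < b /\ changes_sign_at f x0.
Proof.
  intros Hf Hab Hfa Hfb.
  assert (Hnear : forall x e, 0 < e -> exists delta, 0 < delta /\
            forall y, Rabs (y - x) < delta -> Rabs (f y - f x) < e).
  { intros x e He.
    assert (Hc : continuity_pt f x).
    { apply continuity_pt_filterlim, (ex_derive_continuous f x).
      now apply real_analytic_ex_derive. }
    destruct (proj1 (continuity_pt_locally _ _) Hc (mkposreal e He)) as [delta Hdelta].
    exists delta. split; [apply cond_pos|]. exact Hdelta. }
  destruct (completeness (fun x => a <= x <= b /\ f x < 0)) as [s [Hub Hlub]].
  { exists b. intros x [Hx _]. lra. }
  { exists a. split; [lra|exact Hfa]. }
  assert (Has : a <= s) by (apply Hub; split; [lra|exact Hfa]).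
  assert (Hsb : s <= b) by (apply Hlub; intros x [Hx _]; lra).
  assert (Hright : forall x, s < x <= b -> 0 <= f x).
  { intros x Hx. apply Rnot_lt_le. intros Hfx.
    assert (x <= s) by (apply Hub; split; [lra|exact Hfx]). lra. }
  assert (Hleft : forall e, 0 < e -> exists x, s - e < x <= s /\ a <= x /\ f x < 0).
  { intros e He. apply NNPP. intros Hno.
    assert (s <= s - e); [|lra].
    apply Hlub. intros x [Hx Hfx]. apply Rnot_lt_le. intros Hlt. apply Hno.
    exists x. repeat split; try lra. apply Hub. now split. }
  assert (Hs_le : f s <= 0).
  { apply Rnot_lt_le. intros Hpos.
    destruct (Hnear s (f s) Hpos) as (delta & Hdelta & Hc).
    destruct (Hleft delta Hdelta) as (x & Hx & _ & Hfx).
    assert (Hd : Rabs (x - s) < delta) by (apply Rabs_def1; lra).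
    apply Hc, Rabs_def2 in Hd. lra. }
  assert (Hs_lt : s < b) by (destruct (Req_dec s b) as [->|]; lra).
  assert (Hs0 : f s = 0).
  { apply Rle_antisym; [exact Hs_le|]. apply Rnot_lt_le. intros Hneg.
    destruct (Hnear s (- f s)) as (delta & Hdelta & Hc); [lra|].
    (* If [f s < 0], then [f] would still be negative at [s + h]; the cap [b - s] keeps this point
       where [Hright] applies. *)
    set (h := Rmin (delta / 2) (b - s)).
    assert (0 < h) by (apply Rmin_pos; lra).
    assert (h <= delta / 2) by apply Rmin_l.
    assert (h <= b - s) by apply Rmin_r.
    assert (Hd : Rabs (s + h - s) < delta) by (apply Rabs_def1; lra).
    apply Hc, Rabs_def2 in Hd.
    assert (0 <= f (s + h)) by (apply Hright; lra). lra. }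
  assert (Has' : a < s) by (destruct (Req_dec a s) as [<-|]; lra).
  exists s. split; [lra|].
  destruct (real_analytic_one_sided_sign f s Hf) as (e & He & Hsgn).
  set (eps := Rmin e (b - s)).
  assert (0 < eps) by (apply Rmin_pos; lra).
  assert (eps <= e) by apply Rmin_l.
  assert (eps <= b - s) by apply Rmin_r.
  (* The negative value at [z] rules out local vanishing and fixes the sign on the left of [s]. *)
  destruct (Hleft eps) as (z & Hz & _ & Hfz); [assumption|].
  assert (Hzs : z < s) by (destruct (Req_dec z s) as [->|]; lra).
  assert (Habs : forall x, s - eps < x < s + eps -> Rabs (x - s) < e)
    by (intros x Hx; apply Rabs_def1; lra).
  destruct Hsgn as [Hzero|Hsgn].
  { rewrite Hzero in Hfz by (apply Habs; lra). lra. }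
  exists eps. split; [assumption|left]. split; intros x Hx.
  - assert (0 < f x * f z); [|nra].
    apply Hsgn; [apply Habs; lra..|nra].
  (* Pairing [x] with itself gives [f x <> 0], which makes the bound from [Hright] strict. *)
  - assert (0 < f x * f x) by (apply Hsgn; [apply Habs; lra..|nra]).
    assert (0 <= f x) by (apply Hright; lra). nra.
Qed.

(** * Symmetry of the streamlines *)

Lemma Derive_reflection_center (f : R -> R) (x0 : R) : ex_derive f x0 ->
  (forall t, f (x0 + t) = f (x0 - t)) -> Derive f x0 = 0.
Proof.
  intros Hex Hsym.
  assert (Hp : is_derive (fun t => f (x0 + t)) 0 (Derive f x0)).
  { auto_derive; rewrite Rplus_0_r; [tauto|change (fun x => f x) with f; ring]. }
  assert (Hm : is_derive (fun t => f (x0 + t)) 0 (- Derive f x0)).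
  { apply is_derive_ext with (fun t => f (x0 - t)).
    - intros t. now rewrite Hsym.
    - auto_derive; rewrite Ropp_0, Rplus_0_r; [tauto|change (fun x => f x) with f; ring]. }
  apply is_derive_unique in Hp, Hm. lra.
Qed.

Lemma continuous_on_fluid_vertical (d : R) (eta : R -> R) (f : R -> R -> R)
  (x : R) : continuous_on_fluid d eta f ->
  continuous_on (fun y => in_fluid d eta x y) (f x).
Proof.
  intros Hf y Hy.
  apply (filterlim_comp _ _ _ (fun t => (x, t)) (fun p => f (fst p) (snd p))
           _ (within (fun p => in_fluid d eta (fst p) (snd p)) (locally (x, y))));
    [|exact (Hf (x, y) Hy)].
  intros Q [e He]. exists e. intros t Ht Hin. apply He; [|exact Hin].
  split; [apply ball_center|exact Ht].
Qed.

(* The mean value theorem needs two-sided continuity at the endpoints, where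
   [f] is only continuous from inside; so it is applied to [f] precomposed
   with the projection onto [[a, b]]. *)
Lemma is_derive_0_endpoints_eq (f : R -> R) (a b : R) : a <= b ->
  continuous_on (fun y => a <= y <= b) f ->
  (forall y, a < y < b -> is_derive f y 0) -> f a = f b.
Proof.
  intros Hab Hc Hd.
  set (p := fun y => Rmax a (Rmin y b)).
  assert (Hp_in : forall y, a <= p y <= b).
  { intros y. unfold p, Rmax, Rmin. repeat destruct Rle_dec; lra. }
  assert (Hp_id : forall y, a <= y <= b -> p y = y).
  { intros y Hy. unfold p, Rmax, Rmin. repeat destruct Rle_dec; lra. }
  assert (Hp_lip : forall y z, Rabs (p z - p y) <= Rabs (z - y)).
  { intros y z. unfold p, Rmax, Rmin, Rabs.
    repeat destruct Rle_dec; repeat destruct Rcase_abs; lra. }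
  destruct (MVT_gen (fun y => f (p y)) a b (fun _ => 0)) as (xi & _ & Hxi).
  - rewrite Rmin_left, Rmax_right by exact Hab. intros y Hy.
    apply is_derive_ext_loc with f; [|now apply Hd].
    apply (locally_interval _ y a b); [apply Hy..|].
    intros z Hz1 Hz2. simpl in Hz1, Hz2. rewrite Hp_id; [reflexivity|lra].
  - intros y _. apply continuity_pt_filterlim.
    apply (filterlim_comp _ _ _ p f _ (within (fun z => a <= z <= b) (locally (p y))));
      [|now apply Hc].
    intros Q [e He]. exists e. intros z Hz. apply He; [|apply Hp_in].
    change (Rabs (p z - p y) < e). change (Rabs (z - y) < e) in Hz.
    now apply Rle_lt_trans with (Rabs (z - y)).
  - rewrite !Hp_id in Hxi by lra. lra.
Qed.

(** On the two verticals [psi] has the same [y]-derivative [u - c] and vanishes at the same surface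
    height, so the difference is constant and zero. It serves for [x' = - x] and
    [x' = x + 2 * PI]. *)
Lemma stream_function_eq_of_u_eq (d c : R) (eta : R -> R)
  (u v psi : R -> R -> R) (x x' : R) :
  stream_function d c eta u v psi -> eta x' = eta x ->
  (forall y, in_fluid d eta x y -> u x' y = u x y) ->
  forall y, in_fluid d eta x y -> psi x' y = psi x y.
Proof.
  intros [Hcont _ Hpsi_y Hsurf] Heta Hu y Hy.
  assert (H : psi x' y - psi x y = psi x' (eta x) - psi x (eta x)).
  { unfold in_fluid in *.
    apply (is_derive_0_endpoints_eq (fun t => psi x' t - psi x t)).
    - lra.
    - intros t Ht.
      assert (Hside : forall w, eta w = eta x ->
                continuous_on (fun t => y <= t <= eta x) (psi w)).
      { intros w Hw.
        apply continuous_on_subset with (fun t => in_fluid d eta w t).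
        - unfold in_fluid. intros. lra.
        - now apply continuous_on_fluid_vertical. }
      apply (filterlim_comp_2 (H := locally (opp (psi x t)))
               (psi x') (fun t => opp (psi x t)) plus (Hside x' Heta t Ht));
        [|exact (filterlim_plus (psi x' t) (opp (psi x t)))].
      apply (filterlim_comp _ _ _ (psi x) opp _ _ _ (Hside x eq_refl t Ht)).
      exact (filterlim_opp (psi x t)).
    - intros t Ht.
      replace 0 with (minus (u x' t - c) (u x t - c)).
      + apply (is_derive_minus (psi x') (psi x)); apply Hpsi_y;
          unfold in_fluid_interior; lra.
      + rewrite Hu by lra. unfold minus, plus, opp; simpl. ring. }
  rewrite Hsurf, <- Heta, Hsurf in H. lra.
Qed.

(** The point [(x', Y x)] lies in the fluid at level [k], and the level set meets each vertical only
    once. *)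
Lemma streamline_eq_of_psi_eq (d : R) (eta : R -> R) (psi : R -> R -> R)
  (Y : R -> R) (x x' : R) : is_streamline d eta psi Y -> eta x' = eta x ->
  (forall y, in_fluid d eta x y -> psi x' y = psi x y) -> Y x' = Y x.
Proof.
  intros [k Hk] Heta Hpsi. symmetry.
  destruct (proj2 (Hk x (Y x)) eq_refl) as [Hin Hval].
  apply (proj1 (Hk x' (Y x))). split.
  - unfold in_fluid in *. now rewrite Heta.
  - now rewrite Hpsi.
Qed.

Theorem theorem3p1 (g d c Patm : R) (eta : R -> R) (u v P psi : R -> R -> R)
  (hg : 0 < g) (hd : 0 < d)
  (hwave : stokes_wave g d c Patm eta u v P psi)
  (Y : R -> R) (hY : is_streamline d eta psi Y) (hbed : ~ is_bed d Y) :
  exists x0 : R, 0 < x0 < PI /\ inflection_at Y x0.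
Proof.
  assert (Hpi := PI_RGT_0).
  assert (HYa : real_analytic Y) by (apply hwave, hY).
  assert (Hdec : forall x, 0 < x < PI -> Derive Y x < 0)
    by (apply (streamlines_monotone _ _ _ _ _ _ _ _ _ hwave); assumption).
  assert (Heven : forall x, Y (- x) = Y x).
  { intros x. apply (streamline_eq_of_psi_eq d eta psi); [exact hY|apply hwave|].
    apply (stream_function_eq_of_u_eq d c eta u v); [apply hwave..|].
    intros y Hy. now apply hwave. }
  assert (Hper : forall x, Y (x + 2 * PI) = Y x).
  { intros x. apply (streamline_eq_of_psi_eq d eta psi); [exact hY|apply hwave|].
    apply (stream_function_eq_of_u_eq d c eta u v); [apply hwave..|].
    intros y Hy. now apply hwave. }
  assert (H0 : Derive Y 0 = 0).
  { apply Derive_reflection_center; [now apply real_analytic_ex_derive|].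
    intros t. rewrite <- Heven. f_equal. ring. }
  assert (HPI : Derive Y PI = 0).
  { apply Derive_reflection_center; [now apply real_analytic_ex_derive|].
    (* Evenness followed by a shift of one period is the reflection about [PI]:
       [PI + t = - (PI - t) + 2 * PI]. *)
    intros t. rewrite <- (Heven (PI - t)), <- (Hper (- (PI - t))).
    f_equal. ring. }
  assert (Hmvt : forall a b, a < b -> exists xi, a < xi < b /\
            Derive Y b - Derive Y a = Derive (Derive Y) xi * (b - a)).
  { intros a b Hab.
    destruct (MVT_cor2 (Derive Y) (Derive (Derive Y)) a b Hab) as (xi & He & Hxi).
    - intros x _. apply is_derive_Reals, Derive_correct.
      now apply real_analytic_ex_derive, real_analytic_Derive.
    - now exists xi. }
  assert (Hmid : Derive Y (PI / 2) < 0) by (apply Hdec; lra).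
  (* The slope falls from 0 to a negative value on [[0, PI / 2]] and returns to 0 on [[PI / 2, PI]],
     so the second derivative is negative at [a] and positive at [b]. *)
  destruct (Hmvt 0 (PI / 2)) as (a & Ha & Hea); [lra|].
  destruct (Hmvt (PI / 2) PI) as (b & Hb & Heb); [lra|].
  destruct (real_analytic_changes_sign (Derive (Derive Y)) a b)
    as (x0 & Hx0 & Hsign).
  - now apply real_analytic_Derive, real_analytic_Derive.
  - lra.
  - nra.
  - nra.
  - exists x0. split; [lra|exact Hsign].
Qed.
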